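(* Let $G$ be a countable sofic group with sofic approximation $\Sigma=(\sigma_n:G\to\mathrm{Sym}(V_n))_{n\ge 1}$, and let $(\mathcal{X}^G,\mu,S,d)$ be a metric $G$-process. If $\mathcal{X}$ is finite, then $$\mathrm{h}^{\mathrm{m}}_\Sigma(\mu)=\sup\Big\{\limsup_{i\to\infty}\frac{1}{|V_{n_i}|}\log\mathrm{cov}_\varepsilon(\mu_i):\ \varepsilon>0,\ n_i\uparrow\infty,\ \mu_i\stackrel{\mathrm{lde}}{\longrightarrow}\mu\ \text{over}\ (\sigma_{n_i})_{i\ge1}\Big\}$$ $$=\sup\Big\{\limsup_{i\to\infty}\frac{1}{|V_{n_i}|}\mathrm{H}(\mu_i):\ n_i\uparrow\infty,\ \mu_i\stackrel{\mathrm{lde}}{\longrightarrow}\mu\ \text{over}\ (\sigma_{n_i})_{i\ge1}\Big\}.$$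
   Context: A sofic approximation to $G$ is a sequence of maps $\sigma_n:G\to\mathrm{Sym}(V_n)$, $g\mapsto\sigma_n^g$, with $V_n$ finite nonempty sets, such that $|\{v\in V_n:\sigma_n^g(\sigma_n^h(v))=\sigma_n^{gh}(v)\}|=(1-o(1))|V_n|$ for all $g,h\in G$ and $|\{v\in V_n:\sigma_n^g(v)\ne v\}|=(1-o(1))|V_n|$ for all $g\in G\setminus\{e\}$. A metric $G$-process $(\mathcal{X}^G,\mu,S,d)$ consists of a standard measurable space $\mathcal{X}$, a compact metric $d$ on $\mathcal{X}$ whose Borel sets are the measurable sets of $\mathcal{X}$, the left coordinate-shift action $S$ of $G$ on $\mathcal{X}^G$ (with the convention $(S^gx)_h=x_{hg}$, compatible with the pullback names below), and an $S$-invariant Borel probability measure $\mu$ on $\mathcal{X}^G$. $\mathrm{Prob}(Y)$ denotes the Borel probability measures on $Y$; $\mathrm{Prob}(\mathcal{X}^G)$ carries the weak$^\ast$ topology coming from the product topology on $\mathcal{X}^G$. For $\mathbf{x}\in\mathcal{X}^{V_n}$ and $v\in V_n$ the pullback name is $\Pi^{\sigma_n}_v(\mathbf{x})=(x_{\sigma_n^g(v)})_{g\in G}\in\mathcal{X}^G$, and the empirical distribution is $P^{\sigma_n}_{\mathbf{x}}=\frac{1}{|V_n|}\sum_{v\in V_n}\delta_{\Pi_v^{\sigma_n}(\mathbf{x})}$. For $U\subseteq\mathrm{Prob}(\mathcal{X}^G)$ let $\Omega(U,\sigma_n)=\{\mathbf{x}\in\mathcal{X}^{V_n}:P^{\sigma_n}_{\mathbf{x}}\in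 U\}$. For $\mu_n\in\mathrm{Prob}(\mathcal{X}^{V_n})$: local weak$^\ast$ convergence $\mu_n\stackrel{\mathrm{lw}\ast}{\longrightarrow}\mu$ over $\Sigma$ means $|\{v\in V_n:(\Pi_v^{\sigma_n})_\ast\mu_n\in U\}|=(1-o(1))|V_n|$ for every weak$^\ast$ neighbourhood $U$ of $\mu$. LE-convergence $\mu_n\stackrel{\mathrm{le}}{\longrightarrow}\mu$ means $\mu_n\stackrel{\mathrm{lw}\ast}{\longrightarrow}\mu$ and $\mu_n(\Omega(U,\sigma_n))\to1$ for every weak$^\ast$ neighbourhood $U$ of $\mu$. LDE convergence $\mu_n\stackrel{\mathrm{lde}}{\longrightarrow}\mu$ means $\mu_n\times\mu_n\stackrel{\mathrm{le}}{\longrightarrow}\mu\times\mu$ over $\Sigma$, where $\mathcal{X}^{V_n}\times\mathcal{X}^{V_n}=(\mathcal{X}\times\mathcal{X})^{V_n}$ and $\mathcal{X}^G\times\mathcal{X}^G=(\mathcal{X}\times\mathcal{X})^G$. The same definitions apply to $\mu_i\in\mathrm{Prob}(\mathcal{X}^{V_{n_i}})$ over a subsequence $(\sigma_{n_i})_{i\ge1}$, $n_1<n_2<\cdots$. On $\mathcal{X}^{V}$, $V$ finite, $d^{(V)}(\mathbf{x},\mathbf{y})=\frac{1}{|V|}\sum_{v\in V}d(x_v,y_v)$. For $\nu\in\mathrm{Prob}(\mathcal{X}^V)$, $\mathrm{cov}_{\varepsilon,\delta}(\nu,d^{(V)})$ is the least number of $\delta$-balls in $d^{(V)}$ whose union has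 $\nu$-measure more than $1-\varepsilon$. The model-measure sofic entropy is $$\mathrm{h}^{\mathrm{m}}_\Sigma(\mu)=\sup\Big\{\sup_{\delta,\varepsilon>0}\limsup_{i\to\infty}\frac{1}{|V_{n_i}|}\log\mathrm{cov}_{\varepsilon,\delta}(\mu_i,d^{(V_{n_i})}):\ n_i\uparrow\infty,\ \mu_i\stackrel{\mathrm{lde}}{\longrightarrow}\mu\ \text{over}\ (\sigma_{n_i})_{i\ge1}\Big\}.$$ Convention: $\sup\emptyset=-\infty$. For a probability measure $\nu$ on a finite set $Y$ and $\varepsilon>0$, $\mathrm{cov}_\varepsilon(\nu)=\min\{|F|:F\subseteq Y,\ \nu(F)>1-\varepsilon\}$ and $\mathrm{H}(\nu)=-\sum_{y\in Y}\nu\{y\}\log\nu\{y\}$. *)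

(* Defs.v *)
From HB Require Import structures.
From mathcomp Require Import all_boot all_order all_algebra finmap perm.
From mathcomp Require Import all_classical all_reals all_analysis.

Set Implicit Arguments.
Unset Strict Implicit.
Unset Printing Implicit Defensive.

Import Order.TTheory GRing.Theory Num.Theory.
Import numFieldNormedType.Exports.

Local Open Scope classical_set_scope.
Local Open Scope ring_scope.

(* Neither structure relates its topology to its sigma-algebra: that the latter
   is the Borel one is a separate hypothesis on the alphabet. *)
#[short(type="topMeasurableType")]
HB.structure Definition TopMeasurable d :=
  {T of Topological T & Measurable d T}.

#[short(type="metricMeasurableType")]
HB.structure Definition MetricMeasurable (R : realType) d :=
  {T of Metric R T & Measurable d T}.

HB.instance Definition _ d1 d2 (T1 : topMeasurableType d1)
  (T2 : topMeasurableType d2) := Topological.on (T1 * T2)%type.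

(* Configurations: X^I with the product topology and the product sigma-algebra.
   For X a compact metric space with its Borel sets and I countable, the latter
   is the Borel sigma-algebra of the former. *)
Definition cfg (I X : Type) : Type := I -> X.

Definition cfg_display : measure_display -> measure_display.
Proof. exact. Qed.

Section cfg.
Context (I : Type).

HB.instance Definition _ (X : pointedType) := Pointed.copy (cfg I X) (I -> X).

HB.instance Definition _ (X : topologicalType) :=
  Topological.copy (cfg I X) {ptws I -> X}.

Section measurable.
Context d (X : measurableType d).

Definition cylinders : set (set (cfg I X)) :=
  \bigcup_i preimage_set_system setT (fun x : cfg I X => x i) measurable.

Let cfg_set0 : <<s cylinders >> set0.
Proof. exact: sigma_algebra0. Qed.

Let cfg_setC A : <<s cylinders >> A -> <<s cylinders >> (~` A).
Proof. exact: sigma_algebraC. Qed.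

Let cfg_bigcup (F : (set (cfg I X))^nat) :
  (forall i, <<s cylinders >> (F i)) -> <<s cylinders >> (\bigcup_i F i).
Proof. exact: sigma_algebra_bigcup. Qed.

HB.instance Definition _ := @isMeasurable.Build (cfg_display d) (cfg I X)
  <<s cylinders >> cfg_set0 cfg_setC cfg_bigcup.
End measurable.

Section measurable_maps.
Context d (X : measurableType d).

Lemma measurable_coord (i : I) : measurable_fun setT (fun x : cfg I X => x i).
Proof.
move=> _ A mA; apply: sub_sigma_algebra; exists i => //.
by exists A.
Qed.

Lemma measurable_cfg d' (T : measurableType d') (f : T -> cfg I X) :
  (forall i, measurable_fun setT (fun t => f t i)) -> measurable_fun setT f.
Proof.
move=> mf; have mcyl := @measurability _ _ T (cfg I X) setT f (@cylinders d X) erefl.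
apply mcyl => _ [_ [i _ [A mA <-]] <-].
by rewrite !setTI; have := mf i measurableT A mA; rewrite setTI.
Qed.
End measurable_maps.

HB.instance Definition _ d (X : topMeasurableType d) := Topological.on (cfg I X).

Definition cfg_zip (X Y : Type) (p : cfg I X * cfg I Y) : cfg I (X * Y) :=
  fun i => (p.1 i, p.2 i).

Lemma measurable_cfg_zip d1 d2 (X : measurableType d1) (Y : measurableType d2) :
  measurable_fun setT (@cfg_zip X Y).
Proof.
apply: measurable_cfg => i; apply/measurable_fun_pairP; split.
- exact: (measurableT_comp (measurable_coord i) measurable_fst).
- exact: (measurableT_comp (measurable_coord i) measurable_snd).
Qed.

HB.instance Definition _ d1 d2 (X : measurableType d1) (Y : measurableType d2) :=
  isMeasurableFun.Build _ _ _ _ (@cfg_zip X Y) (@measurable_cfg_zip _ _ X Y).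

(* mu x nu, carried over by X^I x Y^I = (X x Y)^I. *)
Definition cfg_prod (R : realType) d1 d2 (X : measurableType d1)
    (Y : measurableType d2) (mu : probability (cfg I X) R)
    (nu : probability (cfg I Y) R) : probability (cfg I (X * Y)) R :=
  distribution (mu \x nu)%E (@cfg_zip X Y).
End cfg.

(* The weak* topology on probability measures: the coarsest one making
   nu |-> \int f dnu continuous for every continuous f (on the compact spaces
   considered here every such f is bounded). *)
Section weak_star.
Context d (T : topMeasurableType d) (R : realType).

Definition weak_star : Type := probability T R.

Definition test_function : Type := {f : T -> R | continuous f}.

Definition weak_star_eval (nu : probability T R) : {ptws test_function -> R} :=
  fun f => \int[nu]_x (sval f x).

HB.instance Definition _ :=
  Topological.copy weak_star (initial_topology weak_star_eval).
End weak_star.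

Record finite_model (G : Type) := FiniteModel {
  vertex :> finType;
  vertex_gt0 : (0 < #|vertex|)%N;
  model_perm : G -> {perm vertex} }.

Section model.
Context (G : Type) (R : realType) (s : finite_model G).

Definition vertex_freq (A : set (vertex s)) : R :=
  #|[pred v | `[< A v >]]|%:R / #|s|%:R.

Definition pullback_name (X : Type) (v : vertex s) (x : cfg s X) : cfg G X :=
  fun g => x (model_perm s g v).

Lemma measurable_pullback_name d (X : measurableType d) (v : vertex s) :
  measurable_fun setT (@pullback_name X v).
Proof. by apply: measurable_cfg => g; exact: measurable_coord. Qed.

HB.instance Definition _ d (X : measurableType d) (v : vertex s) :=
  isMeasurableFun.Build _ _ _ _ (@pullback_name X v)
    (@measurable_pullback_name _ X v).

Section empirical.
Context d (X : measurableType d) (x : cfg s X).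
Local Open Scope ereal_scope.

Definition empirical (A : set (cfg G X)) : \bar R :=
  (#|s|%:R^-1)%:E * \sum_(v : s) \d_(pullback_name v x) A.

Let empirical0 : empirical set0 = 0.
Proof. by rewrite /empirical big1 ?mule0// => v _; rewrite measure0. Qed.

Let empirical_ge0 A : 0 <= empirical A.
Proof.
by rewrite mule_ge0 ?lee_fin ?invr_ge0// sume_ge0// => v _; exact: measure_ge0.
Qed.

Let empirical_sigma_additive : semi_sigma_additive empirical.
Proof.
move=> F mF tF mUF; rewrite /empirical.
rewrite [X in X @ _ --> _](_ : _ = fun n => (#|s|%:R^-1)%:E *
    \sum_(v : s) \sum_(0 <= i < n) \d_(pullback_name v x) (F i)); last first.
  apply/funext => n; rewrite exchange_big ge0_sume_distrr// => i _.
  by rewrite sume_ge0// => v _; exact: measure_ge0.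
apply: cvgeZl => //; apply: cvg_nnesum => [v _|v _].
  by apply: nearW => n; rewrite sume_ge0// => i _; exact: measure_ge0.
exact: measure_semi_sigma_additive.
Qed.

HB.instance Definition _ := isMeasure.Build _ _ _ empirical
  empirical0 empirical_ge0 empirical_sigma_additive.

Let empirical_setT : empirical setT = 1.
Proof.
rewrite /empirical; under eq_bigr do rewrite diracT.
rewrite sumEFin -EFinM sumr_const mulVf//.
by rewrite pnatr_eq0 -lt0n vertex_gt0.
Qed.

HB.instance Definition _ :=
  Measure_isProbability.Build _ _ _ empirical empirical_setT.
End empirical.

Definition good_models d (X : topMeasurableType d)
    (U : set (weak_star (cfg G X) R)) : set (cfg s X) :=
  [set x | U (empirical x : probability _ R)].
End model.

Section sofic.
Context (G : groupType) (R : realType).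

Definition sofic_approximation (Sigma : nat -> finite_model G) : Prop :=
  (forall g h : G, vertex_freq R [set v : Sigma n |
      model_perm (Sigma n) g (model_perm (Sigma n) h v) =
      model_perm (Sigma n) (g * h)%g v] @[n --> \oo] --> (1 : R)) /\
  (forall g : G, g != 1%g -> vertex_freq R [set v : Sigma n |
      model_perm (Sigma n) g v != v] @[n --> \oo] --> (1 : R)).

(* Right multiplication on the index, so that
   shift g (pullback_name v x) = pullback_name (model_perm s g v) x
   whenever s is multiplicative at v. *)
Definition shift (X : Type) (g : G) (x : cfg G X) : cfg G X :=
  fun h => x (h * g)%g.

Definition shift_invariant d (X : measurableType d)
    (mu : probability (cfg G X) R) : Prop :=
  forall (g : G) (A : set (cfg G X)), measurable A ->
    mu (shift g @^-1` A) = mu A.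
End sofic.

Section convergence.
Context (G : Type) (R : realType) (Sigma : nat -> finite_model G).

Section local.
Context d (X : topMeasurableType d).
Context (mus : forall n, probability (cfg (Sigma n) X) R).
Context (mu : probability (cfg G X) R).

Definition lw_star_cvg : Prop :=
  forall U : set (weak_star (cfg G X) R), open_nbhs (mu : weak_star _ _) U ->
    vertex_freq R [set v : Sigma n |
      U (distribution (mus n) (@pullback_name G (Sigma n) X v) : probability _ R)]
      @[n --> \oo] --> (1 : R).

(* Neighbourhoods are taken open, so that good_models U is measurable; by
   monotonicity this is no restriction. *)
Definition le_cvg : Prop :=
  lw_star_cvg /\
  forall U : set (weak_star (cfg G X) R), open_nbhs (mu : weak_star _ _) U ->
    mus n (good_models U) @[n --> \oo] --> 1%E.
End local.

Definition lde_cvg d (X : topMeasurableType d)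
    (mus : forall n, probability (cfg (Sigma n) X) R)
    (mu : probability (cfg G X) R) : Prop :=
  le_cvg (fun n => cfg_prod (mus n) (mus n)) (cfg_prod mu mu).
End convergence.

Section covering.
Local Open Scope ereal_scope.
Context (R : realType).

(* Minimum cardinalities, as infima in the extended reals of (nonempty) sets of
   natural numbers. *)
Definition cov d (T : measurableType d) (e : R) (nu : probability T R) : \bar R :=
  ereal_inf [set #|` F|%:R%:E | F in
    [set F : {fset T} | (1 - e)%:E < nu [set` F]]].

Definition mean_dist d (X : metricMeasurableType R d) (V : finType)
    (x y : cfg V X) : R :=
  (#|V|%:R^-1 * \sum_(v : V) mdist (x v) (y v))%R.

Definition cov_dist d (X : metricMeasurableType R d) (V : finType) (e delta : R)
    (nu : probability (cfg V X) R) : \bar R :=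
  ereal_inf [set #|` C|%:R%:E | C in [set C : {fset cfg V X} |
    (1 - e)%:E < nu (\bigcup_(c in [set` C])
                        [set y | (mean_dist c y < delta)%R])]].

(* Only used on finite T: the big operator sums over the finitely many y where
   the summand is nonzero; 0 log 0 = 0 since ln 0 = 0. *)
Definition shannon d (T : measurableType d) (nu : probability T R) : R :=
  (- \sum_(y \in [set: T]) fine (nu [set y]) * ln (fine (nu [set y])))%R.
End covering.

Section entropy.
Local Open Scope ereal_scope.
Context (G : Type) (R : realType) (Sigma : nat -> finite_model G).

Definition limsup_rate (n : nat -> nat) (a : nat -> \bar R) : \bar R :=
  limn_esup (fun i => (#|Sigma (n i)|%:R^-1)%:E * a i).

Definition lde_sequence d (X : topMeasurableType d)
    (mu : probability (cfg G X) R) (n : nat -> nat)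
    (mus : forall i, probability (cfg (Sigma (n i)) X) R) : Prop :=
  {homo n : i j / (i < j)%N} /\ lde_cvg mus mu.

(* ereal_sup set0 = -oo, and lne is the extended logarithm, with lne 0 = -oo. *)
Definition model_measure_entropy d (X : metricMeasurableType R d)
    (mu : probability (cfg G X) R) : \bar R :=
  ereal_sup [set h | exists (n : nat -> nat)
      (mus : forall i, probability (cfg (Sigma (n i)) X) R),
    lde_sequence mu mus /\
    h = ereal_sup [set r | exists delta e : R,
      [/\ (0 < delta)%R, (0 < e)%R &
        r = limsup_rate n (fun i => lne (cov_dist e delta (mus i)))]]].
End entropy.

(* Main.v *)
Require Import Defs.
From HB Require Import structures.
From mathcomp Require Import all_boot all_order all_algebra finmap perm.
From mathcomp Require Import all_classical all_reals all_analysis.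
From mathcomp Require Import measurable_realfun ring lra.

Import Order.TTheory GRing.Theory Num.Theory.
Import numFieldNormedType.Exports.

Local Open Scope classical_set_scope.
Local Open Scope ring_scope.

(** Write [h] for the model-measure entropy, [hcov] for the supremum of the
    exponential growth rates of [cov], and [hsh] for that of the Shannon
    entropy rates.  All three suprema run over the same lde-convergent
    sequences [mus], and are bounded by one another.

    [h = hcov].  A set of measure more than [1 - e] is covered by the balls
    centred at its points, so [cov_dist <= cov].  Conversely a ball of radius
    [delta] for the averaged metric [mean_dist] contains at most
    [expR (b * #|V|)] points, where [b] tends to [0] with [delta], uniformly in
    [V] ([card_ball_le]); hence [cov] exceeds [cov_dist] by a factor of rate at
    most [b] ([lne_cov_le]).

    [hsh <= hcov].  Coding the points of a nearly full set [F] by their index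
    in [F], and the others by their index in the whole space, bounds the
    entropy by [ln #|F| + e * #|V| * ln #|X|] up to a small error
    ([shannon_le_cov]).

    [hcov <= hsh].  The entropy of [mus i] itself may be much smaller than
    [ln (cov e (mus i))], so the sequence has to be changed.  Dividing
    the weights of [mus i] by [e], cutting them at the level
    [1 / cov e (mus i)] and normalizing yields a measure whose density with
    respect to [mus i] is bounded in terms of [e] only, and whose entropy is at
    least [ln (cov e (mus i))] ([cov_tilt]).  No additive constant is lost,
    which matters when the numbers of vertices stay bounded.

    That the new sequence still lde-converges is the main point
    ([lde_cvg_dominated]).  Concentration of the empirical distributions under
    [mus n \x mus n] says that some events have probability tending to [1],
    which clearly passes to measures with bounded density.  It also implies the
    local weak-star half of lde convergence ([concentrates_lw_star_cvg]): for a
    cylinder [A] and [p_v] the probability that the name at [v] lies in [A],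
    the probability that both names of a pair do so is [p_v ^+ 2], and averaging
    over [v] the empirical frequencies of [A `*` A] and [A `*` setT] shows that
    the means of [p_v ^+ 2] and [p_v] tend to [mu A ^+ 2] and [mu A].  So the
    variance of [p_v] tends to [0], and [p_v] is close to [mu A] for most
    vertices.  Cylinders suffice, because a continuous function on [X^G] is
    uniformly close to a function of finitely many coordinates
    ([continuous_window_approx]). *)

(** * Probabilities on finite spaces: covering numbers and entropy *)

(** An infimum of natural numbers is attained, so that [cov] and [cov_dist],
    which are infima in the extended reals, are realized by actual sets. *)
Lemma ereal_inf_card_attained {R : realType} {T : choiceType} (good : set {fset T}) :
  good !=set0 -> exists F, [/\ good F,
    ereal_inf [set (#|` F'|%:R : R)%:E | F' in good] = (#|` F|%:R)%:E &
    forall F', good F' -> (#|` F| <= #|` F'|)%N].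
Proof.
case=> F0 goodF0; pose big n := `[< exists2 F, good F & #|` F| = n >].
have exF : exists n, big n by exists #|` F0|; apply/asboolP; exists F0.
case: (ex_minnP exF) => n /asboolP[F goodF Fn] nmin.
have Fmin F' : good F' -> (#|` F| <= #|` F'|)%N.
  by move=> goodF'; rewrite Fn; apply: nmin; apply/asboolP; exists F'.
exists F; split=> //; apply/eqP; rewrite eq_le; apply/andP; split.
  by apply: ereal_inf_lbound; exists F.
by apply: le_ereal_inf_tmp => _ [F' /= goodF' <-]; rewrite lee_fin ler_nat Fmin.
Qed.

Section mass.
Context {d : measure_display} {T : measurableType d} {R : realType}.
Implicit Types (P : probability T R) (A : set T).

Definition mass P A : R := fine (P A).

Lemma massE P A : measurable A -> (mass P A)%:E = P A.
Proof. by move=> mA; rewrite fineK// fin_num_measure. Qed.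

Lemma mass_ge0 P A : 0 <= mass P A.
Proof. by rewrite fine_ge0. Qed.

Lemma mass_le1 P A : measurable A -> mass P A <= 1.
Proof. by move=> mA; rewrite -lee_fin massE// probability_le1. Qed.

Lemma massT P : mass P setT = 1.
Proof. by rewrite /mass probability_setT. Qed.
End mass.

Section finite_probability.
Context {d : measure_display} {T : measurableType d} {R : realType}.
Hypothesis finT : finite_set [set: T].
Hypothesis mT : forall A : set T, measurable A.
Implicit Types (P Q : probability T R) (A : set T).

Let E := fset_set [set: T].

Lemma massC P A : mass P (~` A) = 1 - mass P A.
Proof. by rewrite /mass probability_setC// -massE// -EFinB. Qed.

Lemma mem_enumT y : y \in E.
Proof. by rewrite in_fset_set// inE. Qed.

Lemma mass_sum P A : mass P A = \sum_(y <- E) mass P [set y] * \1_A y.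
Proof.
have finA : finite_set A by exact: sub_finite_set finT.
apply: EFin_inj; rewrite massE//.
have {1}-> : A = \bigcup_(y in A) [set y].
  by apply/seteqP; split => [y Ay|y [z Az ->]//]; exists y.
rewrite measure_fin_bigcup//; last by move=> i j _ _ [x [-> ->]].
rewrite -sumEFin; under [RHS]eq_bigr do rewrite EFinM massE//.
rewrite -[RHS](@fsbig_finite _ _ _ _ _
  (fun y : T => (P [set y] * (\1_A y)%:E)%E))// [LHS]fsbig_mkcond.
apply: eq_fsbigr => y _; rewrite /patch indicE.
by case: (y \in A); rewrite ?mule1 ?mule0.
Qed.

Lemma sum_enum_indic A (f : T -> R) :
  \sum_(y <- E) f y * \1_A y = \sum_(y <- fset_set A) f y.
Proof.
have finA : finite_set A by exact: sub_finite_set finT.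
rewrite -!fsbig_finite// [RHS]fsbig_mkcond; apply: eq_fsbigr => y _.
by rewrite /patch indicE; case: (y \in A); rewrite ?mulr1 ?mulr0.
Qed.

Lemma sum_mass P : \sum_(y <- E) mass P [set y] = 1.
Proof.
by rewrite -(massT P) mass_sum; apply: eq_bigr => y _; rewrite indicT mulr1.
Qed.

(** The measure is built as a finite sum of scaled Dirac masses; normalizing,
    which changes nothing since the total mass is [1], provides the structure
    of a probability. *)
Lemma probability_of_weights (w : T -> R) : (forall y, 0 <= w y) ->
  \sum_(y <- E) w y = 1 ->
  exists P : probability T R, forall y, mass P [set y] = w y.
Proof.
move=> w0 w1.
pose m k : {measure set T -> \bar R} :=
  mscale (NngNum (w0 (nth point E k))) (@dirac _ T (nth point E k) R).
pose M : {measure set T -> \bar R} := msum m (size E).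
have ME A : M A = (\sum_(y <- E) w y * \1_A y)%:E.
  rewrite /M/= /msum/= -sumEFin (big_nth point) big_mkord.
  by apply: eq_bigr => k _; rewrite /mscale/= EFinM -diracE.
pose P := mnormalize M (@dirac _ T point R).
have MT : M setT = 1%E.
  by rewrite ME -[in RHS]w1; congr EFin; apply: eq_bigr => y _; rewrite indicT mulr1.
exists P => y; rewrite /mass /P/= /mnormalize MT.
rewrite onee_eq0/= invr1 mule1 ME/=.
rewrite (bigD1_seq y) ?mem_enumT ?fset_uniq//= indicE mem_set// mulr1.
rewrite big1 ?addr0// => z /eqP zy; rewrite indicE memNset ?mulr0//.
Qed.

Lemma card_sum_indic A : (#|` fset_set A|%:R : R) = \sum_(y <- E) \1_A y.
Proof.
rewrite (eq_bigr (fun y => 1 * \1_A y)) => [|y _]; last by rewrite mul1r.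
by rewrite sum_enum_indic big_const_seq count_predT iter_addr_0.
Qed.

Lemma cov_attained (e : R) P : 0 < e -> exists F : {fset T},
  [/\ 1 - e < mass P [set` F], cov e P = (#|` F|%:R)%:E &
      forall F' : {fset T}, 1 - e < mass P [set` F'] -> (#|` F| <= #|` F'|)%N].
Proof.
move=> e0; have covP (F : {fset T}) : (1 - e < mass P [set` F]) =
    ((1 - e)%:E < P [set` F])%E by rewrite -massE// lte_fin.
have [|F [PF covF Fmin]] := @ereal_inf_card_attained R _
    [set F : {fset T} | ((1 - e)%:E < P [set` F])%E].
  by exists E; rewrite /= -covP fset_setK// massT ltrBlDr ltrDl.
by exists F; split=> [||F']; rewrite ?covP//; exact: Fmin.
Qed.

Lemma shannonE P :
  shannon P = - \sum_(y <- E) mass P [set y] * ln (mass P [set y]).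
Proof. by rewrite /shannon fsbig_finite. Qed.

(** The pointwise form of Gibbs' inequality: [ln x <= x - 1] at [x = q / p]. *)
Lemma xlnx_ge (p q : R) : 0 <= p -> 0 < q -> p * ln q <= p * ln p + (q - p).
Proof.
rewrite le_eqVlt => /predU1P[<-|p0] q0; first by rewrite !mul0r add0r subr0 ltW.
rewrite -lerBlDl -mulrBr -ln_div ?posrE//.
have -> : q / p = 1 + (q / p - 1) by rewrite addrC subrK.
apply: (@le_trans _ _ (p * (q / p - 1))).
  rewrite ler_wpM2l ?(ltW p0)//; apply: le_ln1Dx.
  by rewrite ltrBrDr addNr divr_gt0.
by rewrite mulrBr mulr1 mulrCA divff ?gt_eqF// mulr1.
Qed.

Lemma shannon_le_cross_entropy P (q : T -> R) : (forall y, 0 < q y) ->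
  \sum_(y <- E) q y <= 1 ->
  shannon P <= - \sum_(y <- E) mass P [set y] * ln (q y).
Proof.
move=> q0 q1; rewrite shannonE lerN2.
apply: (@le_trans _ _ (\sum_(y <- E)
  (mass P [set y] * ln (mass P [set y]) + (q y - mass P [set y])))).
  by apply: ler_sum => y _; rewrite xlnx_ge ?mass_ge0.
by rewrite big_split/= sumrB sum_mass gerDl subr_le0.
Qed.

Lemma shannon_ge_lnV P (c : R) : 0 < c -> (forall y, mass P [set y] <= c^-1) ->
  ln c <= shannon P.
Proof.
move=> c0 pc; rewrite shannonE -[leLHS]mul1r -(sum_mass P) mulr_suml -sumrN.
apply: ler_sum => y _; have := mass_ge0 P [set y].
rewrite le_eqVlt => /predU1P[<-|p0]; first by rewrite !mul0r oppr0.
rewrite -mulrN ler_wpM2l ?(ltW p0)// lerNr -lnV ?posrE//.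
by rewrite ler_ln ?posrE ?invr_gt0.
Qed.

Lemma card_cover_gt0 P (F : {fset T}) (e : R) : e <= 1 ->
  1 - e < mass P [set` F] -> (0 < #|` F|)%N.
Proof.
move=> e1 PF; rewrite lt0n; apply/eqP => /cardfs0_eq F0; move: PF.
have -> : [set` F] = set0 by apply/seteqP; split => // y /=; rewrite F0.
by rewrite /mass measure0 ltNge subr_ge0 e1.
Qed.

(** The comparison measure [q] gives mass [1 - e] uniformly to [F], and mass [e]
    uniformly to the whole space. *)
Lemma shannon_le_cov P (F : {fset T}) (e : R) : 0 < e < 1 ->
  1 - e < mass P [set` F] ->
  shannon P <= ln #|` F|%:R + e * ln #|` E|%:R - (ln (1 - e) + e * ln e).
Proof.
move=> /andP[e0 e1] PF; pose f : R := #|` F|%:R; pose n : R := #|` E|%:R.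
have f0 : 0 < f by rewrite ltr0n (card_cover_gt0 P F e (ltW e1)).
have n1 : 1 <= n by rewrite ler1n lt0n cardfs_eq0; apply/fset0Pn; exists point; exact: mem_enumT.
have n0 : 0 < n by exact: lt_le_trans n1.
pose q y := (1 - e) / f * \1_[set` F] y + e / n.
have ef0 : 0 < (1 - e) / f by rewrite divr_gt0 ?subr_gt0.
have en0 : 0 < e / n by rewrite divr_gt0.
have q0 y : 0 < q y by rewrite ltr_wpDl// mulr_ge0 ?(ltW ef0)// indicE ler0n.
have q1 : \sum_(y <- E) q y <= 1.
  rewrite big_split/= -mulr_sumr.
  rewrite (eq_bigr (fun y => 1 * \1_[set` F] y)) => [|y _]; last by rewrite mul1r.
  rewrite sum_enum_indic set_fsetK !big_const_seq !count_predT !iter_addr_0.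
  rewrite -mulr_natr mul1r -[(e / n) *+ _]mulr_natr !divfK ?gt_eqF//.
  by rewrite subrK.
apply: (le_trans (shannon_le_cross_entropy P q q0 q1)).
have e1' : 0 < 1 - e by rewrite subr_gt0.
have qF y : - (mass P [set y] * ln (q y)) <= mass P [set y] * \1_[set` F] y *
     (ln f - ln (1 - e)) + mass P [set y] * \1_(~` [set` F]) y * (ln n - ln e).
  rewrite -mulrN -!mulrA -mulrDr ler_wpM2l ?mass_ge0// !indicE in_setC.
  have [yF|yF] /= := boolP (y \in [set` F]).
    rewrite mul1r mul0r addr0 -opprB lerN2 -ln_div ?posrE// ler_ln ?posrE//.
    by rewrite /q indicE yF mulr1 lerDl ltW.
  rewrite mul0r mul1r add0r -opprB lerN2 -ln_div ?posrE// ler_ln ?posrE//.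
  by rewrite /q indicE (negbTE yF) mulr0 add0r.
rewrite -sumrN; apply: (le_trans (ler_sum _ (fun y _ => qF y))).
rewrite big_split/= -!mulr_suml -!mass_sum massC.
have lf0 : 0 <= ln f by rewrite ln_ge0// ler1n -(ltr0n R).
have ln0 : 0 <= ln n by rewrite ln_ge0.
have le0 : ln e <= 0 by rewrite ln_le0 ?ltW.
have le1 : ln (1 - e) <= 0 by rewrite ln_le0// lerBlDr lerDl ltW.
have m1 := mass_le1 P _ (mT [set` F]).
set m := mass _ _ in PF m1 *.
have -> : ln f + e * ln n - (ln (1 - e) + e * ln e) =
  (ln f - ln (1 - e)) + e * (ln n - ln e) by ring.
apply: lerD.
  by rewrite ler_piMl// subr_ge0 (le_trans le1).
by apply: ler_wpM2r; [rewrite subr_ge0 (le_trans le0)|rewrite lerBlDr addrC -lerBlDr ltW].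
Qed.

(** With [L] the covering number, [Q] is the normalization of
    [min (P / e) (1 / L)].  The sum [S] of these truncated weights is at least
    [1]: either at least [L] points reach the level [1 / L] and contribute that
    much each, or they are fewer than [L], hence too few to carry mass more than
    [1 - e], and the remaining ones have mass at least [e] under [P].  Normalizing therefore
    only decreases the weights, so they are still at most [1 / L], which forces
    the entropy up to [ln L].  The constant [1 + e^-1] also covers the case
    [L = 0], which occurs when [e > 1] and where [Q = P]. *)
Lemma cov_tilt (e : R) P : 0 < e -> exists Q : probability T R,
  (forall y, mass Q [set y] <= (1 + e^-1) * mass P [set y]) /\
  (lne (cov e P) <= (shannon Q)%:E)%E.
Proof.
move=> e0; have [F [PF -> Fmin]] := cov_attained e P e0.
have [->|] := eqVneq #|` F| 0%N.
  exists P; split => [y|]; last by rewrite le0_lneNy ?leNye.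
  by rewrite ler_peMl ?mass_ge0// lerDl invr_ge0 ltW.
rewrite -lt0n -(ltr0n R); set L : R := _%:R => L0.
pose g y := Num.min (mass P [set y] / e) L^-1.
have g0 y : 0 <= g y.
  by rewrite le_min divr_ge0 ?mass_ge0 ?(ltW e0)//= invr_ge0 ltW.
pose A := [set y | L^-1 <= mass P [set y] / e].
have finA : finite_set A by exact: sub_finite_set finT.
have S1 : 1 <= \sum_(y <- E) g y.
  have [LA|AL] := leqP #|` F| #|` fset_set A|.
    apply: (@le_trans _ _ (\sum_(y <- E) L^-1 * \1_A y)).
      rewrite sum_enum_indic big_const_seq count_predT iter_addr_0 -mulr_natr.
      by rewrite mulrC ler_pdivlMr// mul1r ler_nat.
    apply: ler_sum => y _; rewrite indicE /g; have [yA|_] := boolP (y \in A).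
      by rewrite mulr1 le_min lexx andbT; move: yA; rewrite inE.
    by rewrite mulr0 g0.
  have PA : mass P A <= 1 - e.
    rewrite leNgt; apply/negP => PA; move: AL; rewrite ltnNge Fmin//.
    by rewrite fset_setK.
  apply: (@le_trans _ _ (\sum_(y <- E) mass P [set y] * \1_(~` A) y / e)).
    by rewrite -mulr_suml -mass_sum ler_pdivlMr// mul1r massC lerBrDr addrC -lerBrDr.
  apply: ler_sum => y _; rewrite indicE in_setC; have [yA|/negP yA] := boolP (y \in A).
    by rewrite mulr0 mul0r g0.
  rewrite mulr1 /g le_min lexx/= ltW// ltNge; apply/negP => h.
  by apply: yA; rewrite inE.
have S0 := lt_le_trans ltr01 S1; set S := \sum_(y <- E) _ in S0 S1.
have gS y : g y / S <= g y by rewrite ler_pdivrMr// ler_peMr.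
have [Q QE] : exists Q : probability T R, forall y, mass Q [set y] = g y / S.
  apply: probability_of_weights => [y|]; first by rewrite divr_ge0// ltW.
  by rewrite -mulr_suml divff ?gt_eqF.
exists Q; split => [y|].
  rewrite QE (le_trans (gS y))// /g ge_min; apply/orP; left.
  by rewrite mulrC ler_wpM2r ?mass_ge0// lerDr.
rewrite lne_EFin// lee_fin shannon_ge_lnV// => y.
by rewrite QE (le_trans (gS y))// /g ge_min lexx orbT.
Qed.

Lemma mass_dominated P Q (C : R) : (forall y, mass Q [set y] <= C * mass P [set y]) ->
  forall A, mass Q A <= C * mass P A.
Proof.
move=> QP A; rewrite (mass_sum Q) (mass_sum P) mulr_sumr; apply: ler_sum => y _.
by rewrite mulrA ler_wpM2r.
Qed.
End finite_probability.

(** * Configurations on finitely many vertices *)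
Section finite_configurations.
Context {d : measure_display} {X : measurableType d} (V : finType).
Hypothesis finX : finite_set [set: X].

Let FX := fset_set [set: X].

Let in_FX x : x \in FX. Proof. exact: mem_enumT. Qed.

(** Plain functions from [V] to [X], as finite functions into a finite type, so
    that the distributivity of products over sums applies. *)
Let of_ffun (f : {ffun V -> FX}) : cfg V X := fun v => val (f v).

Let of_ffun_surj y : exists f, of_ffun f = y.
Proof.
exists [ffun v => FSetSub (in_FX (y v))].
by apply/funext => v; rewrite /of_ffun ffunE.
Qed.

Let of_ffun_inj : injective of_ffun.
Proof.
by move=> f g fg; apply/ffunP => v; apply: val_inj; exact: (congr1 (@^~ v) fg).
Qed.

Lemma finite_cfg : finite_set [set: cfg V X].
Proof.
have -> : [set: cfg V X] = of_ffun @` setT.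
  by apply/seteqP; split=> // y _; have [f <-] := of_ffun_surj y; exists f.
exact: finite_image.
Qed.

Lemma measurable_cfg_finite : (forall A : set X, measurable A) ->
  forall A : set (cfg V X), measurable A.
Proof.
move=> mX A; have -> : A = \bigcup_(y in A) [set y].
  by apply/seteqP; split => [y Ay|y [z Az ->]//]; exists y.
apply: fin_bigcup_measurable => [|y _]; first exact: sub_finite_set finite_cfg.
have -> : [set y] = \bigcap_(v in [set: V]) ((fun x : cfg V X => x v) @^-1` [set y v]).
  apply/seteqP; split => [_ -> //|x xy]; apply/funext => v; exact: xy.
apply: fin_bigcap_measurable => // v _.
by rewrite -[X in measurable X]setTI; exact: measurable_coord.
Qed.

Lemma sum_cfg_prod {R : comNzRingType} (f : V -> X -> R) :
  \sum_(y <- fset_set [set: cfg V X]) \prod_(v : V) f v (y v) =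
  \prod_(v : V) \sum_(x <- FX) f v x.
Proof.
have perm_cfg : perm_eq (fset_set [set: cfg V X]) (map of_ffun (index_enum {ffun V -> FX})).
  apply: uniq_perm; first exact: fset_uniq.
    by rewrite map_inj_uniq ?index_enum_uniq.
  move=> y; rewrite mem_enumT; last exact: finite_cfg.
  by have [h <-] := of_ffun_surj y; rewrite map_f// mem_index_enum.
rewrite (perm_big _ perm_cfg) big_map.
under [RHS]eq_bigr do rewrite big_seq_fsetE.
by rewrite bigA_distr_bigA.
Qed.

Lemma card_cfg : #|` fset_set [set: cfg V X]| = (#|` FX| ^ #|V|)%N.
Proof.
have : \sum_(y <- fset_set [set: cfg V X]) (1 : int) = \prod_(v : V) \sum_(x <- FX) 1.
  by rewrite -(sum_cfg_prod (fun _ _ => 1)); apply: eq_bigr => y _; rewrite big1.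
rewrite prodr_const !big_const_seq !count_predT !iter_addr_0 -natrX.
by move/eqP; rewrite eqr_nat => /eqP.
Qed.
End finite_configurations.

(** * Covering by balls *)
Section averaged_metric.
Context {R : realType} {d : measure_display} (X : metricMeasurableType R d).
Hypothesis finX : finite_set [set: X].
Hypothesis mX : forall A : set X, measurable A.

(** Markov's inequality in exponential form: a point [y] of the ball around [c]
    satisfies [expR (- beta * \sum_v mdist (c v) (y v)) >= expR (- beta * delta * #|V|)],
    while the sum of these weights over all [y] is the product over [v] of
    [\sum_x expR (- beta * mdist (c v) x)], each factor of which is close to [1]
    when [beta] is large. *)
Lemma card_ball_le (b : R) : 0 < b -> exists2 delta : R, 0 < delta &
  forall (V : finType) (c : cfg V X), (0 < #|V|)%N ->
    #|` fset_set [set y : cfg V X | mean_dist c y < delta]|%:R <=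
    expR (b * #|V|%:R).
Proof.
move=> b0; pose FX := fset_set [set: X].
(* since [expR (- s) <= 1 / s], the part of the factor at [a] coming from
   [x != a] is at most [D a / beta]; the term at [x = a] is [0], as [0^-1 = 0] *)
pose D (a : X) : R := \sum_(x <- FX) (mdist a x)^-1.
have D0 a : 0 <= D a by apply: sumr_ge0 => x _; rewrite invr_ge0 mdist_ge0.
pose M : R := 1 + \sum_(a <- FX) D a.
have DM a : D a <= M.
  rewrite /M (bigD1_seq a) ?mem_enumT ?fset_uniq//= addrCA lerDl addr_ge0//.
  by apply: sumr_ge0 => x _; exact: D0.
have M0 : 0 < M by rewrite ltr_wpDr// sumr_ge0.
pose beta := M / (b / 2).
have b20 : 0 < b / 2 by rewrite divr_gt0.
have beta0 : 0 < beta by rewrite divr_gt0.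
have expDx (a x : X) : expR (- (beta * mdist a x)) <= \1_[set a] x + (mdist a x)^-1 / beta.
  have [->|ax] := eqVneq a x.
    by rewrite mdistxx mulr0 oppr0 expR0 indicE mem_set// invr0 mul0r addr0.
  have d0 : 0 < mdist a x by rewrite mdist_gt0.
  rewrite indicE memNset ?add0r; last by move/esym/eqP; exact/negP.
  have bd0 : 0 < mdist a x * beta by exact: mulr_gt0.
  rewrite expRN -invfM lef_pV2 ?posrE ?expR_gt0 ?bd0//.
  by rewrite (le_trans _ (expR_ge1Dx _))// mulrC lerDr.
have sum_exp (c : X) : \sum_(x <- FX) expR (- (beta * mdist c x)) <= expR (b / 2).
  apply: (le_trans (ler_sum _ (fun x _ => expDx c x))).
  rewrite big_split/= -card_sum_indic// fset_set1 cardfs1 -mulr_suml.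
  rewrite (le_trans _ (expR_ge1Dx _))// lerD2l ler_pdivrMr//.
  by rewrite /beta mulrC divfK ?gt_eqF//; exact: DM.
exists (b / 2 / beta) => [|V c V0]; first by rewrite divr_gt0.
have finV := finite_cfg V finX.
set B := [set y | _].
have V0' : 0 < #|V|%:R :> R by rewrite ltr0n.
suff : #|` fset_set B|%:R * expR (- (b / 2 * #|V|%:R)) <= expR (b / 2 * #|V|%:R).
  rewrite expRN ler_pdivrMr ?expR_gt0// -expRD -mulrDl -splitr//.
rewrite (card_sum_indic finV) mulr_suml.
have -> : expR (b / 2 * #|V|%:R) = \prod_(v : V) expR (b / 2).
  by rewrite prodr_const -expRM_natr.
apply: (@le_trans _ _ (\sum_(y <- fset_set [set: cfg V X])
    \prod_(v : V) expR (- (beta * mdist (c v) (y v))))); last first.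
  rewrite (sum_cfg_prod V finX (fun v x => expR (- (beta * mdist (c v) x)))).
  by apply: ler_prod => v _; rewrite sum_exp andbT sumr_ge0.
apply: ler_sum => y _; rewrite -expR_sum sumrN -mulr_sumr.
have [yB|yB] := boolP (y \in B); last first.
  by rewrite indicE (negbTE yB) mul0r expR_ge0.
rewrite indicE yB mul1r ler_expR lerN2.
move: yB; rewrite inE /B/= /mean_dist ltr_pdivlMr// mulrC => /ltW.
by rewrite mulrCA mulrC ler_pdivrMr.
Qed.

Lemma cov_dist_le_cov {V : finType} (e delta : R) (nu : probability (cfg V X) R) :
  0 < delta -> (cov_dist e delta nu <= cov e nu)%E.
Proof.
move=> delta0; apply: ereal_inf_le_tmp => _ [F /= nuF <-]; exists F => //=.
apply: (lt_le_trans nuF); apply: le_measure; rewrite ?inE;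
  try exact: measurable_cfg_finite.
move=> y yF; exists y => //=; rewrite /mean_dist big1 ?mulr0// => v _.
exact: mdistxx.
Qed.

(** The union of the balls around an optimal set of centres [C] is itself a set
    of measure more than [1 - e], with at most [#|C| * expR b] points. *)
Lemma lne_cov_le {V : finType} (e delta b : R) (nu : probability (cfg V X) R) :
  0 < delta -> 0 < e ->
  (forall c : cfg V X, #|` fset_set [set y | mean_dist c y < delta]|%:R <= expR b) ->
  (lne (cov e nu) <= lne (cov_dist e delta nu) + b%:E)%E.
Proof.
move=> delta0 e0 ballb; have finV := finite_cfg V finX.
have mV := measurable_cfg_finite V finX mX.
have [F [nuF -> Fmin]] := cov_attained finV mV e nu e0.
pose ball (c : cfg V X) := [set y | mean_dist c y < delta].
have [|C [nuC covC _]] := @ereal_inf_card_attained R _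
    [set C : {fset cfg V X} | ((1 - e)%:E < nu (\bigcup_(c in [set` C]) ball c))%E].
  exists F => /=; apply: (@lt_le_trans _ _ (nu [set` F])).
    by rewrite -massE// lte_fin.
  apply: le_measure; rewrite ?inE//.
  move=> y yF; exists y => //=; rewrite /ball/= /mean_dist big1 ?mulr0// => v _.
  exact: mdistxx.
rewrite /cov_dist covC.
have FC : #|` F|%:R <= #|` C|%:R * expR b :> R.
  pose U := \bigcup_(c in [set` C]) ball c.
  apply: (@le_trans _ _ #|` fset_set U|%:R).
    rewrite ler_nat Fmin// fset_setK; last exact: sub_finite_set finV.
    by rewrite -lte_fin massE//.
  have -> : #|` C|%:R * expR b = \sum_(c <- C) expR b.
    by rewrite big_const_seq count_predT iter_addr_0 mulr_natl.
  apply: (@le_trans _ _ (\sum_(c <- C) #|` fset_set (ball c)|%:R)).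
    rewrite (card_sum_indic finV).
    under [leRHS]eq_bigr do rewrite (card_sum_indic finV).
    rewrite exchange_big; apply: ler_sum => y _.
    have [|yU] := boolP (y \in U); last by rewrite indicE (negbTE yU) sumr_ge0.
    rewrite inE => -[c /= cC yc]; rewrite (bigD1_seq c) ?fset_uniq//=.
    by rewrite !indicE !mem_set//; [rewrite lerDl sumr_ge0|exists c].
  by apply: ler_sum => c _; exact: ballb.
have [->|F0] := eqVneq #|` F| 0%N; first by rewrite [X in (X <= _)%E]le0_lneNy ?leNye.
have F0' : 0 < #|` F|%:R :> R.
  by rewrite ltr0n lt0n.
have C0 : 0 < #|` C|%:R :> R.
  by have := lt_le_trans F0' FC; rewrite pmulr_lgt0 ?expR_gt0//.
rewrite !lne_EFin// -EFinD lee_fin -[b]expRK -lnM ?posrE ?expR_gt0//.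
by rewrite ler_ln ?posrE ?mulr_gt0 ?expR_gt0.
Qed.
End averaged_metric.

(** * Convergence in the weak-star topology *)
Lemma initial_topology_cvgP {S : choiceType} {T : topologicalType} (f : S -> T)
    (F : set_system S) (s : S) : Filter F ->
  F --> (s : initial_topology f) <-> f x @[x --> F] --> f s.
Proof.
move=> FF; split=> [Fs|Ffs].
  exact: cvg_comp Fs (@initial_continuous _ _ f s).
move=> A [_ /= [[B oB <-] Bs BA]].
by apply: filterS BA _; apply: Ffs; exact: open_nbhs_nbhs.
Qed.

Lemma ptws_cvgP {I : Type} {V : topologicalType}
    (F : set_system {ptws I -> V}) (f : {ptws I -> V}) : Filter F ->
  F --> f <-> forall i, g i @[g --> F] --> f i.
Proof.
move=> FF; rewrite cvg_sup; split => Ff i.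
  by have /initial_topology_cvgP := Ff i.
by apply/initial_topology_cvgP; exact: Ff.
Qed.

Lemma cylinder_nbhs {I : Type} {Y : topologicalType} (x : cfg I Y) (i : I) (B : set Y) :
  nbhs (x i) B -> nbhs x [set y : cfg I Y | B (y i)].
Proof.
move=> xB; have /ptws_cvgP /(_ i) :
  (nbhs x : set_system {ptws I -> Y}) --> (x : {ptws I -> Y}) by [].
exact.
Qed.

Section weak_star_convergence.
Context {R : realType} {d : measure_display} {T : topMeasurableType d}.

Lemma weak_star_cvgP (F : set_system (weak_star T R)) (mu : probability T R) :
  Filter F ->
  F --> (mu : weak_star T R) <->
  forall f : test_function T R,
    weak_star_eval nu f @[nu --> F] --> weak_star_eval mu f.
Proof.
move=> FF; rewrite [X in X <-> _]
  (_ : _ = (F --> (mu : initial_topology (@weak_star_eval _ T R))))//.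
rewrite initial_topology_cvgP; split => [h f|h].
  by have /ptws_cvgP /(_ f) := h.
by apply/ptws_cvgP => f; exact: h.
Qed.

Lemma weak_star_nbhs (mu : probability T R) (f : test_function T R) (eta : R) :
  0 < eta -> nbhs (mu : weak_star T R)
   [set nu | `|weak_star_eval nu f - weak_star_eval mu f| < eta].
Proof.
move=> eta0.
have /weak_star_cvgP /(_ f) /cvgrPdist_lt /(_ eta eta0) :
  nbhs (mu : weak_star T R) --> (mu : weak_star T R) by [].
by apply: filterS => nu; rewrite distrC.
Qed.
End weak_star_convergence.

(** * Properties of most vertices *)
Section frequencies.
Context {G : Type} {R : realType}.
Implicit Types (s : finite_model G).

Lemma vertex_count_gt0 s : 0 < #|s|%:R :> R.
Proof. by rewrite ltr0n vertex_gt0. Qed.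

Definition vertex_mean {s} (a : s -> R) : R := #|s|%:R^-1 * \sum_(v : s) a v.

Lemma vertex_freqE {s} (A : set s) : vertex_freq R A = vertex_mean (\1_A).
Proof.
rewrite /vertex_freq /vertex_mean mulrC; congr (_ * _).
rewrite -sum1_card natr_sum big_mkcond/=; apply: eq_bigr => v _.
by rewrite indicE (_ : (v \in [pred v | `[<A v>]]) = (v \in A))//; case: (v \in A).
Qed.

Lemma vertex_mean_le {s} (a b : s -> R) : (forall v, a v <= b v) ->
  vertex_mean a <= vertex_mean b.
Proof.
by move=> ab; rewrite ler_wpM2l ?invr_ge0// ler_sum.
Qed.

Lemma vertex_mean_cst s (c : R) : vertex_mean (fun _ : s => c) = c.
Proof.
rewrite /vertex_mean sumr_const -[c *+ _]mulr_natl mulKf// gt_eqF//.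
exact: vertex_count_gt0.
Qed.

Lemma vertex_meanD {s} (a b : s -> R) :
  vertex_mean (fun v => a v + b v) = vertex_mean a + vertex_mean b.
Proof. by rewrite /vertex_mean big_split/= mulrDr. Qed.

Lemma vertex_meanZ {s} (k : R) (a : s -> R) :
  vertex_mean (fun v => k * a v) = k * vertex_mean a.
Proof. by rewrite /vertex_mean -mulr_sumr mulrCA. Qed.

Lemma vertex_freq_le1 {s} (A : set s) : vertex_freq R A <= 1.
Proof.
rewrite vertex_freqE -(vertex_mean_cst s 1); apply: vertex_mean_le => v.
by rewrite indicE lern1 leq_b1.
Qed.

Lemma le_vertex_freq {s} {A B : set s} : A `<=` B ->
  vertex_freq R A <= vertex_freq R B.
Proof.
move=> AB; rewrite !vertex_freqE; apply: vertex_mean_le => v.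
by rewrite !indicE ler_nat; have [/set_mem/AB vB|//] := boolP (v \in A); rewrite mem_set.
Qed.

Lemma vertex_freqI {s} (A B : set s) :
  vertex_freq R A + vertex_freq R B - 1 <= vertex_freq R (A `&` B).
Proof.
rewrite lerBlDr -(vertex_mean_cst s 1) !vertex_freqE -!vertex_meanD.
apply: vertex_mean_le => v; rewrite !indicE in_setI -!natrD natr1 ler_nat.
by case: (v \in A); case: (v \in B).
Qed.

Lemma vertex_freq_markov {s} (a : s -> R) (eta : R) : 0 < eta ->
  (forall v, 0 <= a v) ->
  1 - eta^-1 * vertex_mean a <= vertex_freq R [set v | a v < eta].
Proof.
move=> eta0 a0; rewrite lerBlDr -(vertex_mean_cst s 1) vertex_freqE -vertex_meanZ.
rewrite -vertex_meanD; apply: vertex_mean_le => v; rewrite indicE.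
have [av|av] := ltP (a v) eta.
  by rewrite mem_set// lerDl mulr_ge0// invr_ge0 ltW.
by rewrite memNset ?add0r ?ler_pdivlMl ?mulr1//= ltNge av.
Qed.

Context {Sigma : nat -> finite_model G}.

Definition typical (A : forall n, set (Sigma n)) : Prop :=
  vertex_freq R (A n) @[n --> \oo] --> (1 : R).

Lemma typicalW {A : forall n, set (Sigma n)} (b : R^nat) :
  (forall n, b n <= vertex_freq R (A n)) -> b @ \oo --> (1 : R) -> typical A.
Proof.
move=> bA b1; apply: (squeeze_cvgr _ b1 (cvg_cst (1 : R))).
by apply: nearW => n; rewrite /= bA vertex_freq_le1.
Qed.

Lemma typicalT : typical (fun n => setT).
Proof.
apply: (@typicalW _ (fun=> 1)) => [n|]; last exact: cvg_cst.
by rewrite vertex_freqE -(vertex_mean_cst (Sigma n) 1) vertex_mean_le// => v; rewrite indicT.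
Qed.

Lemma typicalS {A B : forall n, set (Sigma n)} :
  (forall n, A n `<=` B n) -> typical A -> typical B.
Proof. by move=> AB; apply: typicalW => n; exact: le_vertex_freq. Qed.

Lemma typicalI {A B : forall n, set (Sigma n)} :
  typical A -> typical B -> typical (fun n => A n `&` B n).
Proof.
move=> A1 B1; apply: typicalW => [n|]; first exact: vertex_freqI.
rewrite [X in _ --> X](_ : _ = 1 + 1 - 1); last by rewrite addrK.
by apply: cvgB; [exact: cvgD|exact: cvg_cst].
Qed.

Lemma typical_all (I : eqType) (s : seq I) (A : I -> forall n, set (Sigma n)) :
  (forall i, typical (A i)) ->
  typical (fun n => [set v | forall i, i \in s -> A i n v]).
Proof.
move=> tA; elim: s => [|i s IHs]; first by apply: typicalS typicalT.
apply: typicalS (typicalI (tA i) IHs) => n v /= [Ai As] j.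
by rewrite inE => /predU1P[->//|]; exact: As.
Qed.

Lemma typical_mean {a : forall n, Sigma n -> R} {eta : R} : 0 < eta ->
  (forall n v, 0 <= a n v) -> vertex_mean (a n) @[n --> \oo] --> (0 : R) ->
  typical (fun n => [set v | a n v < eta]).
Proof.
move=> eta0 a0 acvg; apply: typicalW => [n|]; first exact: vertex_freq_markov.
rewrite [X in _ --> X](_ : _ = 1 - eta^-1 * 0); last by rewrite mulr0 subr0.
by apply: cvgB; [exact: cvg_cst|apply: cvgM => //; exact: cvg_cst].
Qed.

(** The families of sets met by the name distribution at most vertices form a
    filter on the space of probabilities, and local weak-star convergence says
    that this filter converges; it is thus enough to look at one test function
    at a time. *)
Lemma lw_star_cvgP {d} {X : topMeasurableType d}
    (mus : forall n, probability (cfg (Sigma n) X) R) (mu : probability (cfg G X) R) :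
  (forall (f : test_function (cfg G X) R) (eta : R), 0 < eta ->
    typical (fun n => [set v : Sigma n |
      `|weak_star_eval (distribution (mus n) (@pullback_name G (Sigma n) X v)) f -
        weak_star_eval mu f| < eta])) ->
  lw_star_cvg mus mu.
Proof.
move=> h U Umu.
pose F : set_system (weak_star (cfg G X) R) := [set B | typical (fun n =>
  [set v : Sigma n | B (distribution (mus n) (@pullback_name G (Sigma n) X v) : probability _ _)])].
have FF : Filter F.
  split; first exact: typicalT.
    by move=> A B; exact: typicalI.
  by move=> A B AB; apply: typicalS => n v; exact: AB.
have Fmu : F --> (mu : weak_star (cfg G X) R).
  apply/weak_star_cvgP => f; apply/cvgrPdist_lt => eta eta0.
  by apply: typicalS (h f eta eta0) => n v /=; rewrite distrC.
exact: (Fmu U (open_nbhs_nbhs Umu)).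
Qed.
End frequencies.

(** * Functions of finitely many coordinates *)
Section finite_alphabet_cylinders.
Context {G : choiceType} {R : realType} {d : measure_display} {Y : topMeasurableType d}.
Hypothesis finY : finite_set [set: Y].
Hypothesis discY : forall y : Y, nbhs y [set y].
Hypothesis mY : forall A : set Y, measurable A.
Implicit Types (S : {fset G}) (x : cfg G Y).

Definition window S x : cfg S Y := fun g => x (val g).

(** Outside of [S] the value is an arbitrary fixed letter. *)
Definition unwindow S (p : cfg S Y) : cfg G Y :=
  fun g => if insub g is Some h then p h else point.

Lemma window_unwindow S x : window S (unwindow S (window S x)) = window S x.
Proof. by apply/funext => g; rewrite /window /unwindow valK. Qed.

Lemma eq_window S x y : (forall g, g \in S -> x g = y g) -> window S x = window S y.
Proof. by move=> xy; apply/funext => g; apply: xy; exact: fsvalP. Qed.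

Lemma eq_windowE {S x y} g : window S x = window S y -> g \in S -> x g = y g.
Proof. by move=> xy gS; exact: (congr1 (@^~ [` gS]%fset) xy). Qed.

Lemma measurable_window S (B : set (cfg S Y)) : measurable (window S @^-1` B).
Proof.
rewrite -[X in measurable X]setTI.
apply: (_ : measurable_fun setT (window S)) => //.
  by apply: measurable_cfg => g; exact: measurable_coord.
exact: measurable_cfg_finite.
Qed.

Lemma window_nbhs S x : nbhs x [set y | window S y = window S x].
Proof.
have : nbhs x (\bigcap_(g in [set` S]) [set y : cfg G Y | y g = x g]).
  by apply: filter_bigI => g _; exact: (@cylinder_nbhs _ _ x g [set x g]).
by apply: filterS => y yx; apply: eq_window => g gS; exact: yx.
Qed.

(** The windows around [x] generate a filter that converges to [x] coordinate by
    coordinate, hence in the product topology. *)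
Lemma nbhs_window x A : nbhs x A -> exists S, [set y | window S y = window S x] `<=` A.
Proof.
pose F := filter_from setT (fun S => [set y | window S y = window S x]).
have FF : Filter F.
  apply: filter_from_filter; first by exists fset0.
  move=> S T _ _; exists (S `|` T)%fset => // y /= yx; split; apply: eq_window => g gS;
    by apply: (eq_windowE g yx); rewrite in_fsetE gS ?orbT.
suff Fx : (F : set_system {ptws G -> Y}) --> (x : {ptws G -> Y}).
  by move=> /Fx [S _ SA]; exists S.
apply/ptws_cvgP => g B /nbhs_singleton Bxg; exists [fset g]%fset => // y /= yx.
by rewrite (eq_windowE g yx) ?in_fsetE.
Qed.

Lemma compact_cfg : compact [set: cfg G Y].
Proof.
have := @tychonoff G (fun=> Y) (fun=> setT) (fun=> finite_compact finY).
by congr (compact _); apply/seteqP; split.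
Qed.

(** Uniform continuity, by compactness of the space of configurations: the
    covering property is applied to the filter of large finite subsets [S]. *)
Lemma continuous_window_approx (f : cfg G Y -> R) (eta : R) :
  continuous f -> 0 < eta ->
  exists S, forall x y, window S x = window S y -> `|f x - f y| < eta.
Proof.
move=> cf eta0.
pose F := filter_from [set: {fset G}] (fun S => [set S' | (S `<=` S')%fset]).
have FF : Filter F.
  apply: filter_from_filter; first by exists fset0.
  move=> S T _ _; exists (S `|` T)%fset => // S' /=; rewrite fsubUset.
  by move=> /andP.
have /compact_near_coveringP/(_ _ F (fun S x => forall y, window S x = window S y ->
    `|f x - f y| < eta) FF) := compact_cfg.
case=> [x _|S _ /(_ S)]; last first.
  by move=> h; exists S => x; apply: h => //=.
have eta20 : 0 < eta / 2 by rewrite divr_gt0.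
have /cvgrPdist_lt /(_ _ eta20) /nbhs_window[S Sx] := cf x.
exists ([set y | window S y = window S x], [set S' | (S `<=` S')%fset]).
  by split; [exact: window_nbhs|exists S].
move=> [z T] /= [zx /fsubsetP ST] y zy.
have yx : window S y = window S x.
  by rewrite -zx; apply/esym/eq_window => g gS; apply: (eq_windowE g zy); exact: ST.
rewrite (_ : f z - f y = (f x - f y) - (f x - f z)); last by ring.
rewrite (le_lt_trans (ler_normB _ _))// (splitr eta) ltrD//; [exact: Sx yx|exact: Sx zx].
Qed.

Definition step_fun S (a : cfg S Y -> R) x : R :=
  \sum_(p <- fset_set [set: cfg S Y]) a p * \1_(window S @^-1` [set p]) x.

Lemma step_funE S a x : step_fun S a x = a (window S x).
Proof.
have finS := finite_cfg S finY.
rewrite /step_fun (bigD1_seq (window S x)) ?mem_enumT ?fset_uniq//=.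
rewrite indicE mem_set// mulr1 big1 ?addr0// => p /eqP px.
by rewrite indicE memNset ?mulr0//= => /esym.
Qed.

Lemma measurable_step_fun S a : measurable_fun setT (step_fun S a).
Proof.
apply: measurable_sum => p; apply: measurable_funM; first exact: measurable_cst.
by apply: measurable_indic; exact: measurable_window.
Qed.

Lemma bounded_integrable (rho : probability (cfg G Y) R) (f : cfg G Y -> R) (M : R) :
  measurable_fun setT f -> (forall x, `|f x| <= M) ->
  rho.-integrable setT (EFin \o f).
Proof.
move=> mf fM; apply: measurable_bounded_integrable => //.
  by rewrite (le_lt_trans (probability_le1 rho measurableT))// ltry.
exists M; split; first exact: num_real.
by move=> z Mz x _; exact: le_trans (fM x) (ltW Mz).
Qed.

Lemma step_fun_bounded S a x :
  `|step_fun S a x| <= \sum_(p <- fset_set [set: cfg S Y]) `|a p|.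
Proof.
rewrite step_funE (bigD1_seq (window S x)) ?mem_enumT ?fset_uniq//=.
  by rewrite lerDl sumr_ge0.
exact: finite_cfg.
Qed.

Lemma Rintegral_step_fun (rho : probability (cfg G Y) R) S a :
  \int[rho]_x step_fun S a x =
  \sum_(p <- fset_set [set: cfg S Y]) a p * mass rho (window S @^-1` [set p]).
Proof.
apply: EFin_inj.
have mind p : measurable_fun setT (\1_(window S @^-1` [set p]) : cfg G Y -> R).
  by apply: measurable_indic; exact: measurable_window.
have iind p : rho.-integrable setT (EFin \o (\1_(window S @^-1` [set p]))).
  apply: (@bounded_integrable _ _ 1) => // x.
  by rewrite indicE ger0_norm// lern1 leq_b1.
rewrite /Rintegral fineK; last first.
  apply: integrable_fin_num => //.
  exact: (bounded_integrable rho _ _ (measurable_step_fun S a) (step_fun_bounded S a)).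
rewrite -sumEFin; under eq_integral do rewrite /step_fun -sumEFin.
rewrite integral_sum//; last first.
  by move=> p; exact: (integrableZl measurableT (a p) (iind p)).
apply: eq_bigr => p _; under eq_integral do rewrite EFinM.
rewrite integralZl//; last exact: iind.
rewrite integral_indic//; last exact: measurable_window.
by rewrite setIT EFinM /mass fineK// fin_num_measure//; exact: measurable_window.
Qed.

(** A continuous function is a uniform limit of step functions, each of them
    measurable for the product sigma-algebra. *)
Lemma continuous_measurable_fun (f : cfg G Y -> R) :
  continuous f -> measurable_fun setT f.
Proof.
move=> cf.
have /choice[S fS] (n : nat) := continuous_window_approx f n.+1%:R^-1 cf
  (etrans (invr_gt0 _) (ltr0Sn R n)).
apply: (@measurable_fun_cvg _ _ _ setT
  (fun n => step_fun (S n) (f \o unwindow (S n))) f) => [n|x _].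
  exact: measurable_step_fun.
apply/cvgrPdist_lt => e e0; near=> n; rewrite step_funE/=.
apply: (@lt_trans _ _ n.+1%:R^-1); first by apply: fS; rewrite window_unwindow.
by near: n; exact: near_infty_natSinv_lt (PosNum e0).
Unshelve. all: by end_near. Qed.

Lemma continuous_bounded (f : cfg G Y -> R) : continuous f ->
  exists M, forall x, `|f x| <= M.
Proof.
move=> cf; have [S fS] := continuous_window_approx f 1 cf ltr01.
exists (\sum_(p <- fset_set [set: cfg S Y]) `|f (unwindow S p)| + 1) => x.
rewrite -[f x](subrK (f (unwindow S (window S x)))) addrC (le_trans (ler_normD _ _))//.
apply: lerD; last by rewrite ltW// fS// window_unwindow.
by have := step_fun_bounded S (f \o unwindow S) x; rewrite step_funE.
Qed.

Lemma Rintegral_window_approx (f : cfg G Y -> R) (eta : R) (S : {fset G}) :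
  continuous f ->
  (forall x y, window S x = window S y -> `|f x - f y| < eta) ->
  forall rho : probability (cfg G Y) R,
  `|\int[rho]_x f x - \sum_(p <- fset_set [set: cfg S Y])
      f (unwindow S p) * mass rho (window S @^-1` [set p])| <= eta.
Proof.
move=> cf fS rho; pose a := f \o unwindow S.
have [M fM] := continuous_bounded f cf.
have mf := continuous_measurable_fun f cf.
have ifn := bounded_integrable rho f M mf fM.
have istep := bounded_integrable rho _ _ (measurable_step_fun S a) (step_fun_bounded S a).
rewrite -(Rintegral_step_fun rho S a) -RintegralB//.
have mD : measurable_fun setT (fun x => f x - step_fun S a x).
  by apply: measurable_funB => //; exact: measurable_step_fun.
have fstep x : `|f x - step_fun S a x| <= eta.
  by rewrite step_funE /a/= ltW// fS// window_unwindow.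
have iD := bounded_integrable rho _ eta mD fstep.
rewrite (le_trans (le_normr_Rintegral _ _))//.
rewrite [leRHS](_ : _ = \int[rho]_x eta); last first.
  by rewrite Rintegral_cst// [fine _](_ : _ = 1) ?mulr1//; exact: massT.
apply: le_Rintegral => //.
  apply: (@bounded_integrable _ _ eta); first exact: measurableT_comp.
  by move=> x; rewrite normr_id.
apply: (@bounded_integrable _ _ `|eta|) => //; exact: measurable_cst.
Qed.

Lemma indic_continuous (W : set (cfg G Y)) (S : {fset G}) :
  (forall x y, window S x = window S y -> W x -> W y) -> continuous (\1_W : cfg G Y -> R).
Proof.
move=> WS x B /nbhs_singleton Bx.
have := window_nbhs S x; apply: filterS => y yx; rewrite /= indicE.
suff -> : (y \in W) = (x \in W) by rewrite -indicE.
by apply/idP/idP; rewrite !inE; exact: WS.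
Qed.

Definition indic_test (W : set (cfg G Y)) (S : {fset G})
    (WS : forall x y, window S x = window S y -> W x -> W y) :
  test_function (cfg G Y) R := exist _ _ (indic_continuous W S WS).

Lemma measurable_window_set W S :
  (forall x y, window S x = window S y -> W x -> W y) -> measurable W.
Proof.
move=> WS; rewrite (_ : W = window S @^-1` (window S @` W)); first exact: measurable_window.
by apply/seteqP; split => [x Wx|x [y Wy /WS]]; [exists x|exact].
Qed.

Lemma weak_star_eval_indic W S WS (rho : probability (cfg G Y) R) :
  weak_star_eval rho (indic_test W S WS) = mass rho W.
Proof.
have mW := measurable_window_set W S WS.
by rewrite /weak_star_eval/= /Rintegral integral_indic// setIT.
Qed.
End finite_alphabet_cylinders.

Lemma dist_unit_interval {R : realFieldType} (a b : R) :
  0 <= a <= 1 -> 0 <= b <= 1 -> `|a - b| <= 1.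
Proof. by rewrite ler_norml => *; lra. Qed.

Lemma dist_trans_approx {R : realFieldType} (a a' b b' e : R) :
  `|a - a'| <= e -> `|b - b'| <= e -> `|a' - b'| <= e + e -> `|a - b| <= e * 4.
Proof. by rewrite !ler_norml => *; lra. Qed.

(** * Empirical distributions and products *)
Section empirical_average.
Context {G : choiceType} {R : realType} {d : measure_display} {Y : topMeasurableType d}.
Hypothesis finY : finite_set [set: Y].
Hypothesis discY : forall y : Y, nbhs y [set y].
Hypothesis mY : forall A : set Y, measurable A.
Context {Sigma : nat -> finite_model G}.

Lemma mass_empirical (s : finite_model G) (z : cfg s Y) (W : set (cfg G Y)) :
  mass (empirical R z : probability _ R) W =
  vertex_mean (fun v => \1_W (pullback_name v z)).
Proof.
rewrite /mass/= /empirical /vertex_mean.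
by under eq_bigr do rewrite diracE; rewrite sumEFin -EFinM.
Qed.

(** Exchanging the sums over vertices and over configurations: the average name
    distribution is the expected empirical distribution. *)
Lemma vertex_mean_name_mass (s : finite_model G) (P : probability (cfg s Y) R)
    (W : set (cfg G Y)) :
  vertex_mean (fun v : s => mass P (pullback_name v @^-1` W)) =
  \sum_(z <- fset_set [set: cfg s Y]) mass P [set z] * mass (empirical R z : probability _ R) W.
Proof.
have finV := finite_cfg s finY; have mV := measurable_cfg_finite s finY mY.
rewrite /vertex_mean.
under eq_bigr do rewrite (mass_sum finV mV).
rewrite exchange_big/= mulr_sumr; apply: eq_bigr => z _.
rewrite mass_empirical /vertex_mean -mulr_sumr mulrCA; congr (_ * (_ * _)).
Qed.

(** If the empirical distribution is close to [mu] with high probability, then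
    so is its expectation on every set [W] that depends on finitely many
    coordinates, because the indicator of [W] is then a test function. *)
Lemma le_cvg_mean_mass (mus : forall n, probability (cfg (Sigma n) Y) R)
    (mu : probability (cfg G Y) R) (W : set (cfg G Y)) (S : {fset G}) :
  (forall U : set (weak_star (cfg G Y) R), open_nbhs (mu : weak_star _ _) U ->
    mus n (good_models U) @[n --> \oo] --> 1%E) ->
  (forall x y, window S x = window S y -> W x -> W y) ->
  vertex_mean (fun v : Sigma n => mass (mus n) (pullback_name v @^-1` W))
    @[n --> \oo] --> mass mu W.
Proof.
move=> hgood WS; apply/cvgrPdist_lt => e e0.
pose f := indic_test discY W S WS : test_function (cfg G Y) R.
have evalf (rho : probability (cfg G Y) R) : weak_star_eval rho f = mass rho W.
  exact: weak_star_eval_indic.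
have e20 : 0 < e / 2 by rewrite divr_gt0.
pose U := interior [set nu : weak_star (cfg G Y) R |
   `|weak_star_eval nu f - weak_star_eval mu f| < e / 2].
have Umu : open_nbhs (mu : weak_star (cfg G Y) R) U.
  by split; [exact: open_interior|exact: weak_star_nbhs].
move: (hgood U Umu) => /fine_cvg /cvgrPdist_lt /(_ _ e20).
apply: filterS => n /=; rewrite -/(mass (mus n) _).
set P := mus n; set B := good_models U => PB.
have finV := finite_cfg (Sigma n) finY; have mV := measurable_cfg_finite (Sigma n) finY mY.
rewrite vertex_mean_name_mass -[mass mu W]mul1r -(sum_mass finV mV P) mulr_suml -sumrB.
apply: (@le_lt_trans _ _ (\sum_(z <- fset_set [set: cfg (Sigma n) Y])
    (mass P [set z] * (e / 2) + mass P [set z] * \1_(~` B) z))).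
  rewrite (le_trans (ler_norm_sum _ _ _))//; apply: ler_sum => z _.
  rewrite -mulrBr normrM ger0_norm ?mass_ge0// -mulrDr ler_wpM2l ?mass_ge0//.
  have [zB|zB] := boolP (z \in B).
    apply: ler_wpDr; first by rewrite indicE.
    move: zB; rewrite inE /B /good_models/= => /interior_subset/=.
    by rewrite !evalf distrC => /ltW.
  rewrite indicE in_setC zB (le_trans _ (_ : 1 <= _))//; last by rewrite lerDr ltW.
  have mW := measurable_window_set finY mY W S WS.
  by apply: dist_unit_interval; rewrite mass_ge0 mass_le1.
rewrite big_split/= -mulr_suml sum_mass// mul1r -mass_sum// massC//.
rewrite [ltRHS](splitr e) ltrD2l.
by apply: le_lt_trans PB; exact: ler_norm.
Qed.
End empirical_average.

Section squares.
Context {R : realType} {d : measure_display} {X : topMeasurableType d}.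
Hypothesis finX : finite_set [set: X].
Hypothesis discX : forall x : X, nbhs x [set x].
Hypothesis mX : forall A : set X, measurable A.

Lemma finite_set_square : finite_set [set: X * X].
Proof. by rewrite -setXTT; exact: finite_setX. Qed.

Lemma nbhs_set1_square (z : X * X) : nbhs z [set z].
Proof.
exists ([set z.1], [set z.2]); first by split; exact: discX.
by case: z => a b [a' b'] /= [-> ->].
Qed.

Lemma measurable_square (A : set (X * X)) : measurable A.
Proof.
have -> : A = \bigcup_(y in A) [set y].
  by apply/seteqP; split => [y Ay|y [z Az ->]//]; exists y.
apply: fin_bigcup_measurable => [|[a b] _].
  exact: sub_finite_set finite_set_square.
have -> : [set (a, b)] = [set a] `*` [set b].
  by apply/seteqP; split => [[x y] [-> ->]//|[x y] /= [-> ->]].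
exact: measurableX.
Qed.

(** The product [A `*` B], seen among configurations of pairs. *)
Definition rect {I : Type} (A B : set (cfg I X)) : set (cfg I (X * X)) :=
  [set z | A (fun i => (z i).1) /\ B (fun i => (z i).2)].

Lemma mass_rect {I : Type} (P : probability (cfg I X) R) A B :
  measurable A -> measurable B ->
  mass (cfg_prod P P) (rect A B) = mass P A * mass P B.
Proof.
move=> mA mB; rewrite /mass /cfg_prod/= /distribution/= /pushforward.
have -> : @cfg_zip I X X @^-1` rect A B = A `*` B.
  by apply/seteqP; split.
by rewrite product_measure1E// fineM// fin_num_measure.
Qed.

Lemma mass_cfg_prod_dominated (V : finType) (P Q : probability (cfg V X) R) (C : R) :
  0 <= C -> (forall y, mass Q [set y] <= C * mass P [set y]) ->
  forall B, mass (cfg_prod Q Q) B <= C ^+ 2 * mass (cfg_prod P P) B.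
Proof.
move=> C0 QP; apply: mass_dominated.
- exact: finite_cfg finite_set_square.
- exact: measurable_cfg_finite finite_set_square measurable_square.
move=> z; have mV := measurable_cfg_finite V finX mX.
have -> : [set z] = rect [set fun i => (z i).1] [set fun i => (z i).2].
  apply/seteqP; split => [_ -> //|y [y1 y2]]; apply/funext => i.
  rewrite [y i]surjective_pairing [z i]surjective_pairing.
  by congr pair; [exact: (congr1 (fun h => h i) y1)|exact: (congr1 (fun h => h i) y2)].
by rewrite !mass_rect// expr2 mulrACA ler_pM ?mass_ge0.
Qed.
End squares.

(** * Stability of lde convergence under bounded densities *)
Section domination.
Context {G : choiceType} {R : realType} {d : measure_display} {X : topMeasurableType d}.
Hypothesis finX : finite_set [set: X].
Hypothesis discX : forall x : X, nbhs x [set x].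
Hypothesis mX : forall A : set X, measurable A.
Context {Sigma : nat -> finite_model G}.

Let finY := finite_set_square finX.
Let discY := nbhs_set1_square discX.
Let mY := measurable_square finX mX.

(** The half of lde convergence that concerns empirical distributions. *)
Definition concentrates (mus : forall n, probability (cfg (Sigma n) X) R)
    (mu : probability (cfg G X) R) : Prop :=
  forall U : set (weak_star (cfg G (X * X)) R),
    open_nbhs (cfg_prod mu mu : weak_star _ _) U ->
    cfg_prod (mus n) (mus n) (good_models U) @[n --> \oo] --> 1%E.

Section concentrated.
Context (mus : forall n, probability (cfg (Sigma n) X) R) (mu : probability (cfg G X) R).
Hypothesis conc : concentrates mus mu.

(** Second moment argument: [var0] is obtained from the means of [p n v] and of
    [p n v ^+ 2], which are the frequencies of [rect A setT] and [rect A A]. *)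
Lemma typical_mass_window (A : set (cfg G X)) (S : {fset G}) (eta : R) : 0 < eta ->
  (forall x y, window S x = window S y -> A x -> A y) ->
  typical (R := R) (fun n => [set v : Sigma n |
    `|mass (mus n) (pullback_name v @^-1` A) - mass mu A| < eta]).
Proof.
move=> eta0 AS; have mA := measurable_window_set finX mX A S AS.
pose p n (v : Sigma n) := mass (mus n) (pullback_name v @^-1` A).
have mean_rect B : measurable B -> (forall x y, window S x = window S y -> B x -> B y) ->
    vertex_mean (fun v : Sigma n => p n v * mass (mus n) (pullback_name v @^-1` B))
      @[n --> \oo] --> mass mu A * mass mu B.
  move=> mB BS; rewrite -mass_rect//.
  have -> : (fun n => vertex_mean (fun v : Sigma n =>
        p n v * mass (mus n) (pullback_name v @^-1` B))) =
      (fun n => vertex_mean (fun v : Sigma n => mass (cfg_prod (mus n) (mus n))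
        (pullback_name v @^-1` rect A B))).
    apply/funext => n; congr vertex_mean; apply/funext => v.
    by rewrite -mass_rect//; exact: measurable_cfg_finite.
  apply: (le_cvg_mean_mass finY discY mY _ _ _ S) => // x y xy [Ax Bx].
  split; [apply: AS Ax|apply: BS Bx]; apply/funext => g;
    by have := congr1 (@^~ g) xy; rewrite /window => ->.
have mean1 : vertex_mean (p n) @[n --> \oo] --> mass mu A.
  have -> : (fun n => vertex_mean (p n)) = (fun n => vertex_mean (fun v : Sigma n =>
      p n v * mass (mus n) (pullback_name v @^-1` setT))).
    by apply/funext => n; congr vertex_mean; apply/funext => v; rewrite preimage_setT massT mulr1.
  by rewrite -[mass mu A]mulr1 -(massT mu); exact: mean_rect.
have mean2 := mean_rect A mA AS.
set m := mass mu A in mean1 mean2 *.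
have var0 : vertex_mean (fun v : Sigma n => (p n v - m) ^+ 2) @[n --> \oo] --> (0 : R).
  have -> : (fun n => vertex_mean (fun v : Sigma n => (p n v - m) ^+ 2)) =
      (fun n => vertex_mean (fun v : Sigma n => p n v * p n v) +
        (- (2 * m)) * vertex_mean (p n) + m ^+ 2).
    apply/funext => n; rewrite -vertex_meanZ -(vertex_mean_cst (Sigma n) (m ^+ 2)).
    rewrite -!vertex_meanD; congr vertex_mean; apply/funext => v; ring.
  rewrite [X in _ --> X](_ : _ = m * m + (- (2 * m)) * m + m ^+ 2); last by ring.
  by apply: cvgD; [apply: cvgD => //; apply: cvgM => //; exact: cvg_cst|exact: cvg_cst].
have eta2 : 0 < eta ^+ 2 by rewrite exprn_gt0.
apply: typicalS (typical_mean eta2 _ var0) => [n v /=|n v]; last exact: sqr_ge0.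
by rewrite -real_normK ?num_real// ltr_pXn2r// nnegrE// ltW.
Qed.

(** The local part of lde convergence is a consequence of concentration.  A test
    function of pairs is replaced by its values on the windows [p] over [S];
    the cylinder at [p] is a rectangle, whose probability is the product of the
    probabilities of two cylinders. *)
Lemma concentrates_lw_star_cvg :
  lw_star_cvg (fun n => cfg_prod (mus n) (mus n)) (cfg_prod mu mu).
Proof.
apply: lw_star_cvgP => -[f cf] eta eta0.
(* integrating against a step function costs [eta / 5] for each of the two
   measures, and comparing the step functions costs [2 * (eta / 5)] *)
have eta50 : 0 < eta / 5 by rewrite divr_gt0.
have [S fS] := continuous_window_approx finY discY f (eta / 5) cf eta50.
pose M := 1 + \sum_(p <- fset_set [set: cfg S (X * X)]) `|f (unwindow S p)|.
have M0 : 0 < M by rewrite ltr_pwDl// sumr_ge0.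
pose theta := eta / 5 / M.
have theta0 : 0 < theta by rewrite divr_gt0.
pose cyl (q : cfg S X) := window S @^-1` [set q] : set (cfg G X).
have cylS q x y : window S x = window S y -> cyl q x -> cyl q y by rewrite /cyl/= => ->.
have mcyl q : measurable (cyl q) by exact: measurable_window.
have := typical_all _ (fset_set [set: cfg S X]) _
  (fun q => typical_mass_window (cyl q) S theta theta0 (cylS q)).
apply: typicalS => n v /= close.
have {}close q : `|mass (mus n) (pullback_name v @^-1` cyl q) - mass mu (cyl q)| < theta.
  by apply: close; apply: mem_enumT; exact: finite_cfg.
set rho := distribution _ _.
have approx := Rintegral_window_approx finY discY mY f (eta / 5) S cf fS.
have := approx rho; have := approx (cfg_prod mu mu).
rewrite /weak_star_eval/=.
set a := \int[rho]_x f x; set b := \int[cfg_prod mu mu]_x f x.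
set sa := \sum_(p <- _) _ * mass rho _; set sb := \sum_(p <- _) _ * mass (cfg_prod mu mu) _.
have sab : `|sa - sb| <= eta / 5 + eta / 5.
  have -> : eta / 5 + eta / 5 = M * (theta + theta).
    by rewrite mulrDr (_ : M * theta = eta / 5)// mulrC divfK ?gt_eqF.
  apply: (@le_trans _ _ (\sum_(p <- fset_set [set: cfg S (X * X)])
      `|f (unwindow S p)| * (theta + theta))); last first.
    by rewrite -mulr_suml ler_wpM2r ?addr_ge0 ?(ltW theta0)// lerDr.
  rewrite -sumrB (le_trans (ler_norm_sum _ _ _))//; apply: ler_sum => p _.
  rewrite -mulrBr normrM ler_wpM2l//.
  have rectE : window S @^-1` [set p] =
      rect (cyl (fun g => (p g).1)) (cyl (fun g => (p g).2)) :> set (cfg G (X * X)).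
    apply/seteqP; split => [z <-//|z [z1 z2]]; apply/funext => g.
    rewrite /window [z _]surjective_pairing [p g]surjective_pairing.
    by congr pair; [exact: (congr1 (fun h => h g) z1)|exact: (congr1 (fun h => h g) z2)].
  rewrite rectE [mass rho _](_ : _ = mass (mus n) (pullback_name v @^-1` cyl (fun g => (p g).1)) *
     mass (mus n) (pullback_name v @^-1` cyl (fun g => (p g).2))); last first.
    by rewrite -mass_rect//; exact: measurable_cfg_finite.
  rewrite mass_rect//.
  have mV := measurable_cfg_finite (Sigma n) finX mX.
  have := close (fun g => (p g).1); have := close (fun g => (p g).2).
  set A2 := cyl _; set A1 := cyl _ => c2 c1.
  set a1 := mass (mus n) _ in c1 *; set a2 := mass (mus n) _ in c2 *.
  rewrite (_ : a1 * a2 - _ = a1 * (a2 - mass mu A2) + (a1 - mass mu A1) * mass mu A2); last by ring.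
  rewrite (le_trans (ler_normD _ _))// !normrM lerD//.
    rewrite -[leRHS]mul1r ler_pM// ?(ltW c2)// ger0_norm ?mass_ge0//.
    by apply: mass_le1; exact: mV.
  rewrite -[leRHS]mulr1 ler_pM// ?(ltW c1)// ger0_norm ?mass_ge0//.
  by apply: mass_le1; exact: mcyl.
move=> hb ha; apply: (le_lt_trans (dist_trans_approx _ _ _ _ _ ha hb sab)).
by rewrite -mulrA gtr_pMr// ltr_pdivrMl// mulr1 ltr_nat.
Qed.
End concentrated.

(** An event has probability under [nus n \x nus n] at most [C ^+ 2] times its
    probability under [mus n \x mus n]; for the complements of the events in
    [concentrates], this still tends to [0]. *)
Lemma lde_cvg_dominated (C : R) (mus nus : forall n, probability (cfg (Sigma n) X) R)
    (mu : probability (cfg G X) R) :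
  0 <= C -> (forall n y, mass (nus n) [set y] <= C * mass (mus n) [set y]) ->
  lde_cvg mus mu -> lde_cvg nus mu.
Proof.
move=> C0 nusmus [_ conc].
suff concn : concentrates nus mu by split => //; exact: concentrates_lw_star_cvg.
move=> U /conc; set a := fun n => cfg_prod (mus n) (mus n) _.
have finV n := finite_cfg (Sigma n) finY.
have mV n := measurable_cfg_finite (Sigma n) finY mY.
move=> a1; apply/fine_cvgP; split.
  by apply: nearW => n; apply: fin_num_measure; exact: mV.
apply: (@squeeze_cvgr _ _ _ _ (fun n => 1 - C ^+ 2 * (1 - fine (a n))) (fun=> 1)).
- apply: nearW => n; pose B : set (cfg (Sigma n) (X * X)) := good_models U.
  suff : 1 - C ^+ 2 * (1 - fine (a n)) <= mass (cfg_prod (nus n) (nus n)) B <= 1 by [].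
  have := mass_cfg_prod_dominated finX mX _ _ _ C C0 (nusmus n) (~` B).
  rewrite !(massC (mV n)) => h; apply/andP; split.
    by rewrite lerBlDr -lerBlDl; exact: h.
  exact: (mass_le1 _ _ (mV n B)).
- rewrite [X in _ --> X](_ : _ = 1 - C ^+ 2 * (1 - 1)); last by rewrite subrr mulr0 subr0.
  apply: cvgB; first exact: cvg_cst.
  apply: cvgM; first exact: cvg_cst.
  by apply: cvgB; [exact: cvg_cst|exact: fine_cvg].
- exact: cvg_cst.
Qed.
End domination.

(** * Growth rates *)
Section limsup.
Context {G : Type} {R : realType} (Sigma : nat -> finite_model G).
Local Open Scope ereal_scope.

Lemma limn_esup_leD (u v : (\bar R)^nat) (eta : R) :
  (forall i, u i <= v i + eta%:E) -> limn_esup u <= limn_esup v + eta%:E.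
Proof.
move=> uv; rewrite -leeBlDr//; apply: le_ereal_inf_tmp => _ [A FA <-].
rewrite leeBlDr//; apply: ge_ereal_inf; exists (ereal_sup (u @` A)); first by exists A.
apply: ge_ereal_sup => _ [k Ak <-]; apply: (le_trans (uv k)); rewrite leeD2r//.
by apply: ereal_sup_ubound; exists k.
Qed.

Lemma limsup_rate_leD (n : nat -> nat) (a b : nat -> \bar R) (eta : R) :
  (forall i, a i <= b i + (eta * #|Sigma (n i)|%:R)%:E) ->
  limsup_rate Sigma n a <= limsup_rate Sigma n b + eta%:E.
Proof.
move=> ab; apply: limn_esup_leD => i.
have V0 : (0 < #|Sigma (n i)|%:R :> R)%R by exact: vertex_count_gt0.
apply: (@le_trans _ _ ((#|Sigma (n i)|%:R^-1)%:E * (b i + (eta * #|Sigma (n i)|%:R)%:E))).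
  by rewrite lee_pmul2l// ?lte_fin ?invr_gt0.
by rewrite muleDr ?fin_num_adde_defl// -EFinM mulrC mulfK ?gt_eqF.
Qed.

Lemma limsup_rate_le (n : nat -> nat) (a b : nat -> \bar R) :
  (forall i, a i <= b i) -> limsup_rate Sigma n a <= limsup_rate Sigma n b.
Proof.
move=> ab; rewrite -[leRHS]adde0; apply: limsup_rate_leD => i.
by rewrite mul0r adde0.
Qed.
End limsup.

Lemma le_lne {R : realType} (x y : \bar R) : (x <= y)%E -> (lne x <= lne y)%E.
Proof.
move=> xy; have [x0|x0] := leP x 0%E; first by rewrite [lne x]le0_lneNy ?leNye.
have y0 := lt_le_trans x0 xy.
by rewrite lee_lne// in_itv/= leey andbT ltW.
Qed.

(** Taking [e = t ^+ 2], the three terms are at most [t * L], [2 * t ^+ 2] and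
    [2 * t]: the last one since [- ln t <= t^-1]. *)
Lemma small_entropy_error {R : realType} (L eta : R) : 0 <= L -> 0 < eta ->
  exists2 e : R, 0 < e < 1 & e * L - (ln (1 - e) + e * ln e) <= eta.
Proof.
move=> L0 eta0; pose t := Num.min eta 1 / (L + 4).
have L40 : 0 < L + 4 by rewrite ltr_wpDl.
have t0 : 0 < t by rewrite divr_gt0// lt_min eta0 ltr01.
have tL : t * (L + 4) <= eta by rewrite divfK ?gt_eqF// ge_min lexx.
have tL1 : t * (L + 4) <= 1 by rewrite divfK ?gt_eqF// ge_min lexx orbT.
have t4 : t * 4 <= 1 by rewrite (le_trans _ tL1)// ler_pM2l// lerDr.
have tt0 : 0 < t ^+ 2 by rewrite exprn_gt0.
have tt : t ^+ 2 * 4 <= t by rewrite expr2 -mulrA ler_piMr// ltW.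
exists (t ^+ 2); first by rewrite tt0; lra.
have ln1e : - ln (1 - t ^+ 2) <= 2 * t ^+ 2.
  have e1 : 0 < 1 - t ^+ 2 by lra.
  rewrite -lnV ?posrE//.
  have -> : (1 - t ^+ 2)^-1 = 1 + t ^+ 2 / (1 - t ^+ 2) by field; rewrite gt_eqF.
  apply: (le_trans (le_ln1Dx _)).
    by rewrite (lt_trans (ltrN10 _))// divr_gt0.
  by rewrite ler_pdivrMr// mulrAC ler_peMl//; lra.
have lnt : - ln t <= t^-1.
  by rewrite -lnV ?posrE// ltW// ln_sublinear// invr_gt0.
have lne : - (t ^+ 2 * ln (t ^+ 2)) <= 2 * t.
  rewrite lnXn// mulr2n -mulrN opprD.
  have -> : 2 * t = t ^+ 2 * (t^-1 + t^-1) by field; rewrite gt_eqF.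
  by rewrite ler_pM2l// lerD.
have tL0 : t ^+ 2 * L <= t * L.
  by rewrite ler_wpM2r// expr2 ler_piMl// ?ltW//; lra.
rewrite opprD (le_trans _ tL)// mulrDr.
by lra.
Qed.

(** * Finite metric alphabets and the theorem *)
Section finite_metric.
Context {R : realType} {d : measure_display} {X : metricMeasurableType R d}.

Lemma finite_metric_discrete : finite_set [set: X] -> forall x : X, nbhs x [set x].
Proof.
move=> finX x; apply: open_nbhs_nbhs; split=> //.
rewrite -[[set x]]setCK openC.
have /accessible_finite_set_closed := hausdorff_accessible (@metric_hausdorff _ X).
by apply; exact: sub_finite_set finX.
Qed.

Lemma finite_metric_borel : finite_set [set: X] ->
  (measurable : set (set X)) = <<s open >> -> forall A : set X, measurable A.
Proof.
move=> finX -> A; apply: sub_sigma_algebra; rewrite openE => x Ax.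
by apply: filterS (finite_metric_discrete finX x) => _ ->.
Qed.
End finite_metric.

Theorem mainTheorem3 (R : realType)
  (G : groupType) (G_countable : countable [set: G])
  (Sigma : nat -> finite_model G) (Sigma_sofic : sofic_approximation R Sigma)
  (d : measure_display) (X : metricMeasurableType R d)
  (X_compact : compact [set: X])
  (X_borel : (measurable : set (set X)) = <<s open >>)
  (mu : probability (cfg G X) R) (mu_invariant : shift_invariant mu)
  (X_finite : finite_set [set: X]) :
  model_measure_entropy Sigma mu =
    ereal_sup [set h | exists (e : R) (n : nat -> nat)
      (mus : forall i, probability (cfg (Sigma (n i)) X) R),
      [/\ 0 < e, lde_sequence mu mus &
        h = limsup_rate Sigma n (fun i => lne (cov e (mus i)))]] /\
  model_measure_entropy Sigma mu =
    ereal_sup [set h | exists (n : nat -> nat)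
      (mus : forall i, probability (cfg (Sigma (n i)) X) R),
      lde_sequence mu mus /\
      h = limsup_rate Sigma n (fun i => (shannon (mus i))%:E)].
Proof.
have discX := finite_metric_discrete X_finite.
have mX := finite_metric_borel X_finite X_borel.
have finV (s : finite_model G) := finite_cfg s X_finite.
have mV (s : finite_model G) := measurable_cfg_finite s X_finite mX.
pose h := model_measure_entropy Sigma mu.
set hcov := ereal_sup [set _ | exists e n mus, _].
set hsh := ereal_sup [set _ | exists n mus, _ /\ _ = limsup_rate _ _ (fun i => (shannon _)%:E)].
have h_le_cov : (h <= hcov)%E.
  apply: ge_ereal_sup => _ [n [mus [lde ->]]].
  apply: ge_ereal_sup => _ [delta [e [delta0 e0 ->]]].
  apply: (@le_trans _ _ (limsup_rate Sigma n (fun i => lne (cov e (mus i))))).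
    apply: limsup_rate_le => i; apply: le_lne.
    exact: (cov_dist_le_cov X X_finite mX e delta (mus i) delta0).
  by apply: ereal_sup_ubound; exists e, n, mus.
have cov_le_h : (hcov <= h)%E.
  apply: ge_ereal_sup => _ [e [n [mus [e0 lde ->]]]].
  apply/lee_addgt0Pr => eta eta0.
  have [delta delta0 ballV] := card_ball_le X X_finite eta eta0.
  apply: (@le_trans _ _ (limsup_rate Sigma n (fun i => lne (cov_dist e delta (mus i))) + eta%:E)%E).
    apply: limsup_rate_leD => i; apply: lne_cov_le => // c.
    by apply: ballV; exact: vertex_gt0.
  rewrite leeD2r//; apply: le_ereal_sup_tmp; eexists; first by exists n, mus.
  by apply: ereal_sup_ubound; exists delta, e.
have cov_le_sh : (hcov <= hsh)%E.
  apply: ge_ereal_sup => _ [e [n [mus [e0 [n_incr lde] ->]]]].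
  have tilt i := cov_tilt (finV _) (mV _) e (mus i) e0.
  pose nus i := projT1 (cid (tilt i)).
  have nusP i : _ := projT2 (cid (tilt i)).
  apply: (@le_trans _ _ (limsup_rate Sigma n (fun i => (shannon (nus i))%:E))).
    by apply: limsup_rate_le => i; exact: (nusP i).2.
  apply: ereal_sup_ubound; exists n, nus; split=> //; split=> //.
  apply: (lde_cvg_dominated X_finite discX mX (1 + e^-1) mus) => // [|i].
    by rewrite addr_ge0// invr_ge0 ltW.
  exact: (nusP i).1.
have sh_le_cov : (hsh <= hcov)%E.
  apply: ge_ereal_sup => _ [n [mus [lde ->]]].
  apply/lee_addgt0Pr => eta eta0.
  pose K : R := #|` fset_set [set: X]|%:R.
  have K1 : 1 <= K.
    by rewrite ler1n lt0n cardfs_eq0; apply/fset0Pn; exists point; exact: mem_enumT.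
  have [e /andP[e0 e1] err] := small_entropy_error (ln K) eta (ln_ge0 K1) eta0.
  apply: (@le_trans _ _ (limsup_rate Sigma n (fun i => lne (cov e (mus i))) + eta%:E)%E).
    apply: limsup_rate_leD => i.
    have [F [PF -> _]] := cov_attained (finV _) (mV _) e (mus i) e0.
    have F0 := card_cover_gt0 (mus i) F e (ltW e1) PF.
    have V1 : 1 <= #|Sigma (n i)|%:R :> R by rewrite ler1n vertex_gt0.
    rewrite lne_EFin ?ltr0n// -EFinD lee_fin.
    have e01 : 0 < e < 1 by rewrite e0.
    apply: (le_trans (shannon_le_cov (finV _) (mV _) (mus i) F e e01 PF)).
    rewrite -addrA lerD2l card_cfg// natrX lnXn ?(lt_le_trans ltr01 K1)//.
    apply: (le_trans _ (ler_wpM2r (ler0n R _) err)).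
    rewrite mulrBl -[ln K *+ _]mulr_natr mulrA lerD2l lerN2 ler_neMr//.
    rewrite -[leRHS]addr0 lerD//; first by rewrite ln_le0// lerBlDr lerDl ltW.
    by rewrite mulr_ge0_le0 ?ln_le0 ?ltW.
  by rewrite leeD2r//; apply: ereal_sup_ubound; exists e, n, mus.
have hE : h = hcov by apply/eqP; rewrite eq_le h_le_cov cov_le_h.
have shE : hcov = hsh by apply/eqP; rewrite eq_le cov_le_sh sh_le_cov.
by rewrite -shE; split.
Qed.
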